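(* Let $T$ be an $n$-vertex tree. Then $\log n \le f_T(T) \le \frac{n}{2} + \log n + C$ for an absolute constant $C$. These bounds are tight up to lower-order terms: for the path $P_n$ on $n$ vertices, $f_T(P_n) = \lceil n/2 \rceil$, and for the star $K_{1,n-1}$, $f_T(K_{1,n-1}) = \log n + O(1)$.
   Context: $\log$ is base 2. All graphs are finite, simple, connected with at least 4 vertices. A vertex-separating tree system of a graph $G$ is a collection of subgraphs of $G$, each a tree, such that for every pair of distinct vertices $u,v \in V(G)$ some tree in the collection contains exactly one of $u$ and $v$. $f_T(G)$ denotes the minimum size of a vertex-separating tree system of $G$. *)

(* Defs.v *)
From mathcomp Require Import all_boot all_order all_algebra.
From mathcomp Require Import boolp reals exp.

Set Implicit Arguments.
Unset Strict Implicit.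
Unset Printing Implicit Defensive.

Import GRing.Theory.

Record sgraph := SGraph {
  vert :> finType;
  adj : rel vert;
  adj_sym : symmetric adj;
  adj_irr : irreflexive adj }.

Definition edges (G : sgraph) : {set {set G}} :=
  [set [set p.1; p.2] | p : G * G & adj p.1 p.2].

Definition connected (G : sgraph) : Prop :=
  0 < #|G| /\ forall x y : G, connect (@adj G) x y.

(* A closed walk x, y, x along one edge is a duplicate-free [cycle] of size 2,
   hence the explicit lower bound on the length. *)
Definition acyclic (G : sgraph) : Prop :=
  forall c : seq G, 2 < size c -> ~ ucycle (@adj G) c.

Definition is_tree (G : sgraph) : Prop := connected G /\ acyclic G.

(* Candidate subgraphs are pairs (vertex set, edge set), so that they form a
   finType and two subgraphs with the same vertices may differ. *)
Definition presub (G : sgraph) : finType := ({set G} * {set {set G}})%type.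

Definition is_subgraph (G : sgraph) (H : presub G) : Prop :=
  H.2 \subset edges G /\ forall e, e \in H.2 -> e \subset H.1.

Section SubAdj.
Variables (G : sgraph) (H : presub G).

(* The disequality only makes this irreflexive for an arbitrary pair; it is
   redundant when H is a subgraph. *)
Definition sub_adj : rel {x : G | x \in H.1} :=
  [rel u v | (u != v) && ([set val u; val v] \in H.2)].

Lemma sub_adj_sym : symmetric sub_adj.
Proof. by move=> u v; rewrite /sub_adj /= eq_sym setUC. Qed.

Lemma sub_adj_irr : irreflexive sub_adj.
Proof. by move=> u; rewrite /sub_adj /= eqxx. Qed.

Definition sub_sgraph : sgraph := SGraph sub_adj_sym sub_adj_irr.

End SubAdj.

Definition is_subtree (G : sgraph) (H : presub G) : Prop :=
  is_subgraph H /\ is_tree (sub_sgraph H).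

Definition vs_tree_system (G : sgraph) (A : {set presub G}) : Prop :=
  (forall H, H \in A -> is_subtree H) /\
  (forall u v : G, u != v -> exists2 H, H \in A & (u \in H.1) (+) (v \in H.1)).

Definition has_vs_tree_system (G : sgraph) : pred nat :=
  fun k => `[< exists2 A : {set presub G}, vs_tree_system A & #|A| = k >].

Lemma single_vertex_subtree (G : sgraph) (x : G) :
  is_subtree (([set x], set0) : presub G).
Proof.
split; first by split=> [|e]; rewrite ?sub0set ?inE.
have one (u v : sub_sgraph (([set x], set0) : presub G)) : u = v.
  by apply: val_inj; have /set1P -> := valP u; have /set1P -> := valP v.
split; first split.
- by apply/card_gt0P; exists (exist _ x (set11 x)).
- by move=> u v; rewrite (one u v) connect0.
- case=> [|u [|v c]] // _ /andP[_] /=.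
  by rewrite (one u v) in_cons eqxx.
Qed.

(* The single-vertex trees form a vertex-separating tree system. *)
Lemma has_vs_tree_system_ex (G : sgraph) : exists k, has_vs_tree_system G k.
Proof.
pose A := [set (([set x], set0) : presub G) | x : G].
exists #|A|; apply/asboolP; exists A => //; split.
  by move=> _ /imsetP[x _ ->]; exact: single_vertex_subtree.
move=> u v uv; exists ([set u], set0); first exact: imset_f.
by rewrite !inE eqxx eq_sym (negbTE uv).
Qed.

Definition fT (G : sgraph) : nat := ex_minn (has_vs_tree_system_ex G).

Section Path.
Variable n : nat.

Definition path_adj : rel 'I_n :=
  [rel i j : 'I_n | (i.+1 == j :> nat) || (j.+1 == i :> nat)].

Lemma path_adj_sym : symmetric path_adj.
Proof. by move=> i j; rewrite /path_adj /= orbC. Qed.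

Lemma path_adj_irr : irreflexive path_adj.
Proof. by move=> i; rewrite /path_adj /= orbb -[X in _ == X]addn0 -addn1 eqn_add2l. Qed.

Definition path_graph : sgraph := SGraph path_adj_sym path_adj_irr.

End Path.

Section Star.
Variable m : nat.

(* K_{1,m}: the centre is None and the m leaves are the Some i. *)
Definition star_adj : rel (option 'I_m) := [rel u v | isSome u (+) isSome v].

Lemma star_adj_sym : symmetric star_adj.
Proof. by move=> u v; rewrite /star_adj /= addbC. Qed.

Lemma star_adj_irr : irreflexive star_adj.
Proof. by move=> u; rewrite /star_adj /= addbb. Qed.

Definition star_graph : sgraph := SGraph star_adj_sym star_adj_irr.

End Star.

Definition log2 (R : realType) (x : R) : R := (ln x / ln 2)%R.

(* Main.v *)
(** Upper bound.  Every connected set [W] has vertices [x], [y] such that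
    [W' = W \ {x, y}] is still connected and each of [x], [y] has a neighbour in
    [W'].  Take a separating system of [W'] that also covers [W'], let [y] join
    every member containing its neighbour, and add the single tree [W' + x].
    Only [y] is missed by the new tree, and [x] lies in the new tree only, so
    the new system separates and covers [W].  Hence one tree pays for two
    vertices, which gives [n / 2 + 1] trees.

    Path.  A subtree of a path is an interval, hence separates at most two of
    the [n] pairs of cyclically consecutive vertices; conversely the [m]
    intervals of length [m = uphalf n] starting at [0, ..., m - 1] separate.

    Star.  Give the leaves distinct binary codes; the [j]-th tree consists of
    the centre and the leaves whose [j]-th bit is 1. *)
Require Import Defs.
From mathcomp Require Import all_boot all_order all_algebra.
From mathcomp Require Import boolp reals exp.
From mathcomp Require Import zify lra.

Set Implicit Arguments.
Unset Strict Implicit.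
Unset Printing Implicit Defensive.

Import Order.TTheory GRing.Theory Num.Theory.
Local Open Scope nat_scope.

(** * Connectivity by cuts *)

Lemma connected_crossing (G : sgraph) (a : {pred G}) (x y : G) :
  connected G -> x \in a -> y \notin a ->
  exists u v, [/\ u \in a, v \notin a & adj u v].
Proof.
move=> [_ conG] xa ya; apply: contrapT => nocross.
have cl : closed (@adj G) a.
  apply: intro_closed => [|u v uv ua]; first exact/sym_connect_sym/adj_sym.
  by apply: contrapT => /negP va; apply: nocross; exists u, v.
by move: ya; rewrite -(closed_connect cl (conG x y)) xa.
Qed.

Section CutConnected.
Variable G : sgraph.
Implicit Types (W M : {set G}) (x y : G).

(* Connectivity of the subgraph induced by [W], expressed by cuts so that no
   walk in a subtype has to be manipulated. *)
Definition cutconn W : Prop :=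
  W != set0 /\
  forall M a b, a \in W -> a \in M -> b \in W -> b \notin M ->
    exists u v, [/\ u \in W, u \in M, v \in W, v \notin M & adj u v].

Lemma cutconn1 x : cutconn [set x].
Proof.
split; first by apply/set0Pn; exists x; rewrite set11.
by move=> M a b /set1P -> xM /set1P ->; rewrite xM.
Qed.

Lemma cutconnU1 W x y : cutconn W -> x \in W -> adj x y -> cutconn (y |: W).
Proof.
move=> [W0 cW] xW xy; split.
  by apply/set0Pn; exists y; rewrite !inE eqxx.
have lift M a b : a \in W -> a \in M -> b \in W -> b \notin M ->
    exists u v, [/\ u \in y |: W, u \in M, v \in y |: W, v \notin M & adj u v].
  move=> aW aM bW bM; have [u [v [uW uM vW vM uv]]] := cW _ _ _ aW aM bW bM.
  by exists u, v; split=> //; rewrite inE (uW, vW) orbT.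
move=> M a b /setU1P[-> | aW] aM /setU1P[-> | bW] bM.
- by rewrite aM in bM.
- have [xM | xM] := boolP (x \in M); first exact: (lift M x b).
  by exists y, x; split; rewrite // ?inE ?eqxx ?xW ?orbT // adj_sym.
- have [xM | xM] := boolP (x \in M); last exact: (lift M a x).
  by exists x, y; split; rewrite // !inE ?eqxx ?xW ?orbT.
- exact: (lift M a b).
Qed.

Lemma cutconn_setT : connected G -> cutconn [set: G].
Proof.
move=> conG; split; first by rewrite -card_gt0 cardsT; case: conG.
move=> M a b _ aM _ bM.
have [u [v [uM vM uv]]] := connected_crossing conG aM bM.
by exists u, v; split; rewrite ?inE.
Qed.

(** Take a largest connected proper subset [M] of [W] containing [x]. Some edge leaves [M] inside
    [W]; adding its far end [y] keeps the set connected, so by maximality it gives all of [W]. *)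
Lemma cutconn_peel W x : cutconn W -> x \in W -> 1 < #|W| ->
  exists y p, [/\ y \in W, y != x, cutconn (W :\ y), p \in W :\ y & adj p y].
Proof.
move=> cW xW W1.
pose P := [pred M : {set G} | [&& `[< cutconn M >], x \in M & M \proper W]].
have P1 : P [set x].
  apply/and3P; split; [exact/asboolP/cutconn1 | exact: set11 |].
  by rewrite properEcard sub1set xW cards1.
case: (arg_maxnP (fun M : {set G} => #|M|) P1) => M /= /and3P[/asboolP cM xM].
move=> /properP[MW [b bW bM]] maxM.
have [u [y [uW uM yW yM uy]]] := cW.2 M x b xW xM bW bM.
have cyM := cutconnU1 cM uM uy.
have eqW : y |: M = W.
  apply/eqP; apply: contraT => neW.
  have /maxM : P (y |: M).
    apply/and3P; split; [exact/asboolP | by rewrite inE xM orbT |].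
    by rewrite properEneq neW subUset sub1set yW.
  by rewrite /= cardsU1 yM ltnn.
have WyM : W :\ y = M by rewrite -eqW setU1K.
exists y, u; rewrite WyM; split=> //.
by apply: contraNneq yM => ->.
Qed.

(** * Separating and covering with about half as many connected sets *)

Definition separates (W : {set G}) (F : {set {set G}}) : Prop :=
  {in W &, forall u v, u != v ->
    exists2 H : {set G}, H \in F & (u \in H) (+) (v \in H)}.

(* Covering is carried along because it is what makes the induction work. *)
Lemma half_cutconn_system W : cutconn W ->
  exists F : {set {set G}},
    [/\ forall H, H \in F -> cutconn H /\ H \subset W,
        separates W F, W \subset cover F & #|F| <= #|W|./2.+1].
Proof.
have [k] := ubnP #|W|; elim: k W => // k IHk W ltWk cW.
have [r rW] := set0Pn _ cW.1.
have [W1 | W1] := leqP #|W| 1.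
  have W_eq : W = [set r].
    by apply/esym/eqP; rewrite eqEcard sub1set rW cards1.
  exists [set W]; rewrite cards1; split=> //.
  - by move=> _ /set1P ->.
  - by move=> u v; rewrite W_eq => /set1P -> /set1P ->; rewrite eqxx.
  - by rewrite /cover big_set1.
have [y [p [yW _ cWy pWy py]]] := cutconn_peel cW rW W1.
have cardW : #|W| = #|W :\ y|.+1 by rewrite (cardsD1 y W) yW.
(* Two vertices are a base case too: removing both would leave the empty set, which is not
   [cutconn]. *)
have [Wy1 | Wy1] := leqP #|W :\ y| 1.
  have Wy_eq : W :\ y = [set p].
    by apply/esym/eqP; rewrite eqEcard sub1set pWy cards1.
  have W_eq : W = [set y; p] by rewrite -Wy_eq setD1K.
  have /setD1P[p_y pW] := pWy.
  exists [set W; [set p]]; split=> //.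
  - move=> _ /set2P[] ->; split=> //; first exact: cutconn1.
    by rewrite sub1set.
  - move=> u v uW vW uv; exists [set p]; first by rewrite !inE eqxx orbT.
    have y_p : (y == p) = false by rewrite eq_sym (negPf p_y).
    by move: uW vW uv; rewrite W_eq => /set2P[] -> /set2P[] ->;
      rewrite ?eqxx // !inE eqxx y_p.
  - by apply/subsetP => u uW; apply/bigcupP; exists W; rewrite // !inE eqxx.
  - by rewrite cards2; case: eqP => _; move: W1; case: #|W| => [|[|]].
(* The second peeling fixes [p], so that the neighbour of [y] survives in [W']. *)
have [x [q [xWy xp cW' qW' qx]]] := cutconn_peel cWy pWy Wy1.
set W' := W :\ y :\ x in cW' qW'.
have cardWy : #|W :\ y| = #|W'|.+1 by rewrite (cardsD1 x (W :\ y)) xWy.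
have [|F [FW' sepF covF cardF]] := IHk W' _ cW'.
  by rewrite cardW cardWy in ltWk; lia.
have pW' : p \in W' by rewrite in_setD1 eq_sym xp.
have W'W u : u \in W' -> u \in W by rewrite !inE => /and3P[].
have xW' : x \notin W' by rewrite !inE eqxx.
have yW' : y \notin W' by rewrite !inE eqxx andbF.
have /setD1P[xy xW] := xWy.
have W_case u : u \in W -> [\/ u = x, u = y | u \in W'].
  rewrite !inE => ->; case: (u =P x) => [|_]; first by constructor 1.
  by case: (u =P y) => [|_]; [constructor 2 | constructor 3].
pose ext (H : {set G}) : {set G} := if p \in H then y |: H else H.
have extE H u : u != y -> (u \in ext H) = (u \in H).
  by move=> uy; rewrite /ext; case: ifP; rewrite // !inE (negPf uy).
have ext_y H : H \in F -> (y \in ext H) = (p \in H).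
  move=> /FW'[_ /subsetP HW']; rewrite /ext; case: ifP; rewrite ?inE ?eqxx //.
  by move=> _; apply: contraNF yW' => /HW'.
have W'y u : u \in W' -> u != y by apply: contraTneq => ->.
have W'x u : u \in W' -> u != x by apply: contraTneq => ->.
have xF H : H \in F -> x \in ext H = false.
  move=> /FW'[_ /subsetP HW']; rewrite extE //.
  by apply: contraNF xW' => /HW'.
have W'cov u : u \in W' -> exists2 H, H \in F & u \in H.
  by move=> /(subsetP covF)/bigcupP.
exists ((x |: W') |: [set ext H | H in F]); split.
- move=> _ /setU1P[-> | /imsetP[H HF ->]].
    split; first exact: cutconnU1 qx.
    by apply/subsetP => u /setU1P[-> // | /W'W].
  have [cH /subsetP HW'] := FW' _ HF.
  have HW : H \subset W by apply/subsetP => u /HW'/W'W.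
  rewrite /ext; case: ifP => // pH; split; first exact: cutconnU1 py.
  by rewrite subUset sub1set yW.
- have new_in : x |: W' \in (x |: W') |: [set ext H | H in F].
    by rewrite !inE eqxx.
  have ext_in H : H \in F -> ext H \in (x |: W') |: [set ext H | H in F].
    by move=> HF; rewrite inE imset_f ?orbT.
  have y_new : (y \in x |: W') = false.
    by apply/negbTE; rewrite in_setU1 negb_or eq_sym xy.
  (* Covering is needed here: [x] lies in no [ext H], so any member containing [u] tells them
     apart. *)
  have sep_x u : u \in W' -> exists2 H,
      H \in (x |: W') |: [set ext H | H in F] & (x \in H) (+) (u \in H).
    move=> uW'; have [H HF uH] := W'cov u uW'.
    by exists (ext H); [exact: ext_in | rewrite xF // extE ?W'y ?uH].
  move=> u v /W_case[-> | -> | uW'] /W_case[-> | -> | vW'] uv.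
  + by rewrite eqxx in uv.
  + by exists (x |: W'); rewrite // y_new !inE eqxx.
  + exact: sep_x.
  + by exists (x |: W'); rewrite // y_new !inE eqxx.
  + by rewrite eqxx in uv.
  + by exists (x |: W'); rewrite // y_new in_setU1 vW' orbT.
  + by have [H HF] := sep_x u uW'; exists H; rewrite // addbC.
  + by exists (x |: W'); rewrite // y_new in_setU1 uW' orbT.
  + have [H HF sH] := sepF u v uW' vW' uv.
    by exists (ext H); [exact: ext_in | rewrite !extE ?W'y].
- apply/subsetP => u /W_case[-> | -> | uW']; apply/bigcupP.
  + by exists (x |: W'); rewrite !inE eqxx.
  + have [H HF pH] := W'cov p pW'.
    by exists (ext H); rewrite ?ext_y // inE imset_f ?orbT.
  + by exists (x |: W'); rewrite !in_setU1 ?eqxx ?uW' ?orbT.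
- rewrite cardW cardWy /= (leq_trans (leq_card_setU _ _)) // cards1 add1n ltnS.
  exact: leq_trans (leq_imset_card _ _) cardF.
Qed.

(** * From connected vertex sets to subtrees, and general bounds on [fT] *)

Definition induced W : presub G := (W, [set e in edges G | e \subset W]).

Lemma mem_edges u v : ([set u; v] \in edges G) = adj u v.
Proof.
apply/imsetP/idP => [[[a b]] | uv]; last by exists (u, v); rewrite ?inE.
rewrite inE /= => ab uv.
have ne : a != b by apply: contraTneq ab => ->; rewrite adj_irr.
have ua : a \in [set u; v] by rewrite uv set21.
have ub : b \in [set u; v] by rewrite uv set22.
by move: ua ub ab ne => /set2P[] -> /set2P[] ->; rewrite ?eqxx // adj_sym.
Qed.

Lemma sub_adj_induced W (u v : sub_sgraph (induced W)) :
  adj u v = adj (val u) (val v).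
Proof.
rewrite -[LHS]/((u != v) && ([set val u; val v] \in (induced W).2)) inE.
rewrite mem_edges subUset !sub1set (valP u) (valP v).
by case: eqP => [-> | _]; rewrite ?adj_irr /= ?andbT.
Qed.

(** Cycles of the induced subgraph are cycles of [G], so in an acyclic graph a subtree can be given
    by its vertex set alone. *)
Lemma induced_subtree W : acyclic G -> cutconn W -> is_subtree (induced W).
Proof.
move=> acG [W0 cW]; split; [split | split; first split].
- by apply/subsetP => e; rewrite inE => /andP[].
- by move=> e; rewrite inE => /andP[].
- have [x xW] := set0Pn _ W0.
  by apply/card_gt0P; exists (exist _ x xW).
- move=> x y; apply: contrapT => /negP nxy.
  (* The component of [x], viewed in [G]: an edge of [W] leaving it would enlarge it. *)
  pose M := [set val z | z in connect (@adj (sub_sgraph (induced W))) x].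
  have M_val z : (val z \in M) = connect (@adj (sub_sgraph (induced W))) x z.
    by rewrite mem_imset //; exact: val_inj.
  have xM : val x \in M by rewrite M_val.
  have yM : val y \notin M by rewrite M_val.
  have [u [v [uW + vW + uv]]] := cW M _ _ (valP x) xM (valP y) yM.
  rewrite -[u]/(val (exist _ u uW : sub_sgraph (induced W))).
  rewrite -[v]/(val (exist _ v vW : sub_sgraph (induced W))) !M_val => xu /negP.
  by apply; apply: connect_trans xu (connect1 _); rewrite sub_adj_induced.
- move=> c c2 /andP[cyc uc]; apply: (acG (map val c)); rewrite ?size_map //.
  rewrite /ucycle map_inj_uniq ?uc; last exact: val_inj.
  rewrite andbT; case: c cyc {c2 uc} => //= x c.
  rewrite -map_rcons path_map; apply: sub_path => u v uv.
  by rewrite /= -sub_adj_induced.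
Qed.

Lemma fT_le (F : {set {set G}}) : acyclic G ->
  (forall H, H \in F -> cutconn H) -> separates [set: G] F -> fT G <= #|F|.
Proof.
move=> acG cF sF; rewrite /fT; case: ex_minnP => k _ /(_ #|induced @: F|) mink.
apply: leq_trans (leq_imset_card induced F); apply: mink.
apply/asboolP; exists (induced @: F) => //; split.
  by move=> _ /imsetP[H /cF cH ->]; exact: induced_subtree.
move=> u v uv; have [H HF sH] := sF u v (in_setT _) (in_setT _) uv.
by exists (induced H); first exact: imset_f.
Qed.

Lemma fT_attained : exists2 A : {set presub G}, vs_tree_system A & #|A| = fT G.
Proof. by rewrite /fT; case: ex_minnP => k /asboolP. Qed.

Lemma fT_le_half : is_tree G -> fT G <= #|G|./2.+1.
Proof.
move=> [conG acG]; have [F [cF sF _]] := half_cutconn_system (cutconn_setT conG).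
rewrite cardsT => /(leq_trans _); apply.
by apply: fT_le => // H /cF[].
Qed.

(** A vertex is determined by the set of members that contain it. *)
Lemma card_le_exp_fT : #|G| <= 2 ^ fT G.
Proof.
have [A [_ sA] <-] := fT_attained.
pose sig (u : G) := [set H in A | u \in H.1].
have sig_inj : injective sig.
  move=> u v /setP sig_uv; apply: contrapT => /eqP /sA[H HA].
  by have := sig_uv H; rewrite !inE HA /= => ->; rewrite addbb.
rewrite -card_powerset -cardsT -(card_imset _ sig_inj).
apply/subset_leq_card/subsetP => _ /imsetP[u _ ->].
by rewrite inE; apply/subsetP => H; rewrite inE => /andP[].
Qed.

Lemma subtree_crossing (H : presub G) (M : {pred G}) a b : is_subtree H ->
  a \in H.1 -> a \in M -> b \in H.1 -> b \notin M ->
  exists u v, [/\ u \in H.1, u \in M, v \in H.1, v \notin M & adj u v].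
Proof.
move=> [[/subsetP HE _] [cH _]] aH aM bH bM.
have [||u [v [uM vM /andP[_ /HE]]]] :=
  @connected_crossing _ [pred z : sub_sgraph H | val z \in M]
    (exist _ a aH) (exist _ b bH) cH; rewrite ?inE // mem_edges => uv.
by exists (val u), (val v); split; rewrite ?(valP u) ?(valP v).
Qed.

(* On a cycle, a vertex with the largest label has two such neighbours. *)
Lemma acyclic_label (f : G -> nat) :
  (forall u v w, adj u v -> adj u w -> f v <= f u -> f w <= f u -> v = w) ->
  acyclic G.
Proof.
move=> fP c c2 /andP[cyc uc].
have [x0 x0c] : exists x0, x0 \in c.
  by case: c c2 {cyc uc} => // x0 c _; exists x0; rewrite mem_head.
case: (arg_maxnP f x0c) => x /= xc maxx.
(* With [x] rotated to the front, its neighbours on the cycle are the second and the last entries.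
   These are distinct positions because the length exceeds 2, so their equality contradicts
   uniqueness. *)
have [i c' rot_c] := rot_to xc.
have {}maxx y : y \in x :: c' -> f y <= f x.
  by rewrite -rot_c mem_rot => /maxx.
move: c2 cyc uc; rewrite -(size_rot i) -(rot_cycle i) -(rot_uniq i) rot_c.
case: c' maxx {rot_c} => // y c'; case/lastP: c' => // c' z maxx _ /=.
rewrite !rcons_path last_rcons => /and3P[xy _ zx] /and3P[_ + _].
rewrite mem_rcons in_cons negb_or => /andP[/eqP + _]; case.
apply: (fP x) => //; rewrite 1?adj_sym //; apply: maxx.
  by rewrite !inE eqxx orbT.
by rewrite !(inE, mem_rcons) eqxx !orbT.
Qed.

End CutConnected.

(** * Paths *)

Lemma path_acyclic n : acyclic (path_graph n).
Proof.
apply: (@acyclic_label (path_graph n) (@nat_of_ord n)) => u v w /=.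
by rewrite /path_adj /= => uv uw vu wu; apply: ord_inj; lia.
Qed.

(** An edge from the vertices below [k] to the remaining ones can only end at [k]. *)
Lemma path_subtree_convex n (H : presub (path_graph n)) (i j k : 'I_n) :
  is_subtree H -> i \in H.1 -> j \in H.1 -> i <= k <= j -> k \in H.1.
Proof.
move=> tH iH jH /andP[]; rewrite leq_eqVlt => /orP[/eqP/ord_inj <- // | ik kj].
have jk : j \notin [pred z : 'I_n | z < k] by rewrite inE -leqNgt.
have [u [v [_ + vH]]] := @subtree_crossing (path_graph n) H
  [pred z : 'I_n | z < k] i j tH iH ik jH jk.
rewrite !inE => uk vk /= uv; suff -> : k = v by [].
by move: uv; rewrite /path_adj /= => uv; apply: ord_inj; lia.
Qed.

Lemma path_interval_cutconn n (a b : nat) : a <= b -> b < n ->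
  cutconn (G := path_graph n) [set z : 'I_n | a <= z <= b].
Proof.
elim: b => [|b IHb] ab bn.
  rewrite (_ : [set _ | _] = [set Ordinal bn]); first exact: cutconn1.
  by apply/setP => z; rewrite !inE -val_eqE /=; lia.
have [ab' | ba] := leqP a b; last first.
  rewrite (_ : [set _ | _] = [set Ordinal bn]); first exact: cutconn1.
  by apply/setP => z; rewrite !inE -val_eqE /=; lia.
rewrite (_ : [set _ | _] = Ordinal bn |: [set z : 'I_n | a <= z <= b]).
  apply: (@cutconnU1 (path_graph n) _ (Ordinal (ltnW bn))).
  - exact: IHb (ltnW bn).
  - by rewrite inE ab' leqnn.
  - by rewrite /= /path_adj /= eqxx.
by apply/setP => z; rewrite !inE -val_eqE /=; lia.
Qed.

Lemma fT_path_le n : 0 < n -> fT (path_graph n) <= uphalf n.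
Proof.
move=> n0; set m := uphalf n.
pose I (i : 'I_m) : {set path_graph n} := [set z : 'I_n | i <= z <= i + m.-1].
rewrite -[leqRHS]card_ord -cardsT.
apply: leq_trans (leq_imset_card I [set: 'I_m]).
apply: fT_le; first exact: path_acyclic.
  move=> _ /imsetP[i _ ->]; apply: path_interval_cutconn; first exact: leq_addr.
  by have := ltn_ord i; rewrite /m; lia.
have sep (u v : 'I_n) : u < v -> exists i : 'I_m, (u \in I i) (+) (v \in I i).
  move=> uv; have vn := ltn_ord v.
  (* If [m <= u], the interval ending at [u] misses [v]; if [v < m], the one starting at [v] misses
     [u]; otherwise the first interval contains [u] only. *)
  have [um | mu] := ltnP u m; last first.
    have um : u - m.-1 < m by rewrite /m; lia.
    by exists (Ordinal um); rewrite !inE /=; rewrite /m in mu *; lia.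
  have [vm | mv] := ltnP v m.
    by exists (Ordinal vm); rewrite !inE /=; lia.
  have m0 : 0 < m by lia.
  by exists (Ordinal m0); rewrite !inE /=; lia.
move=> u v _ _; rewrite neq_ltn => /orP[] /sep[i si].
  by exists (I i); rewrite // imset_f.
by exists (I i); rewrite 1?addbC // imset_f.
Qed.

Lemma fT_path_ge n : 1 < n -> uphalf n <= fT (path_graph n).
Proof.
case: n => // n n1; have [A [tA sA] <-] := fT_attained (path_graph n.+1).
have ordSE (i : 'I_n.+1) : ordS i = (if i == n :> nat then 0 else i.+1) :> nat.
  rewrite /=; have := ltn_ord i; rewrite ltnS leq_eqVlt.
  by case: eqP => [-> _ | _ /= ltin]; [rewrite modnn | rewrite modn_small].
have cut (i : 'I_n.+1) : exists H, (H \in A) && ((i \in H.1) (+) (ordS i \in H.1)).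
  have [|H HA sH] := sA i (ordS i); last by exists H; rewrite HA.
  by apply/eqP => /(congr1 (@nat_of_ord _)); rewrite ordSE; case: eqP; lia.
pose H i := xchoose (cut i).
have HA i : H i \in A by have /andP[] := xchooseP (cut i).
have HS i : (ordS i \in (H i).1) = (i \notin (H i).1).
  by have /andP[_] := xchooseP (cut i); rewrite -/(H i); do 2!case: (_ \in _).
(* The bit records whether the step from [i] to its cyclic successor leaves or enters [H i]. An
   interval is left once and entered once around the cycle, so [f] is injective and there are at
   most two steps per member. *)
pose f i := (H i, i \in (H i).1).
have f_lt (i j : 'I_n.+1) : i < j -> f i <> f j.
  move=> ij [eqH eqi]; have := HS i; have := HS j; rewrite eqi -eqH.
  have conv := path_subtree_convex (tA _ (HA i)).
  have Si : ordS i = i.+1 :> nat.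
    by rewrite ordSE; have := ltn_ord j; case: eqP; lia.
  have Sj := ordSE j.
  rewrite -eqH in eqi; have [jH | jH] /= := boolP (j \in (H i).1).
    rewrite jH in eqi; move=> _ /negP; apply.
    by apply: (conv i j) => //; lia.
  rewrite (negPf jH) in eqi => SjH SiH.
  (* Both steps enter. If [j] is the last vertex, its successor is 0 and [i] lies between 0 and
     [i.+1]; otherwise [j] lies between [i.+1] and [j.+1]. *)
  case: (j =P n :> nat) Sj => [jn | jn] Sj.
    by case/negP: (negbT eqi); apply: (conv (ordS j) (ordS i)) => //; lia.
  by case/negP: jH; apply: (conv (ordS i) (ordS j)) => //; lia.
have f_inj : injective f.
  move=> i j fij; apply: contrapT => /eqP; rewrite neq_ltn.
  by case/orP=> /f_lt; [exact | move/(_ (esym fij))].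
have : #|f @: [set: 'I_n.+1]| <= #|setX A [set: bool]|.
  apply/subset_leq_card/subsetP => _ /imsetP[i _ ->].
  by rewrite !inE HA.
rewrite card_imset // cardsX !cardsT card_ord card_bool.
by rewrite leq_uphalf_double -muln2.
Qed.

(** * Stars *)

Lemma star_acyclic m : acyclic (star_graph m).
Proof.
apply: (@acyclic_label (star_graph m) (fun u : option 'I_m => isSome u : nat)).
by move=> [u|] [v|] [w|].
Qed.

Lemma star_centre_cutconn m (W : {set star_graph m}) :
  (None : option 'I_m) \in W -> cutconn W.
Proof.
move=> cW; split; first by apply/set0Pn; exists None.
move=> M a b aW aM bW bM.
have [cM | cM] := boolP ((None : option 'I_m) \in M).
  exists None, b; split=> //; case: b bM {bW} => //.
  by rewrite cM.
exists a, None; split=> //; case: a aM {aW} => //.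
by rewrite (negPf cM).
Qed.

Lemma fT_star_le m k : m <= 2 ^ k -> fT (star_graph m) <= k.+1.
Proof.
move=> mk; have mS : m <= #|{set 'I_k}|.
  by rewrite -cardsT -powersetT card_powerset cardsT card_ord.
pose code (i : 'I_m) : {set 'I_k} := enum_val (widen_ord mS i).
have code_inj : injective code.
  by move=> i j /enum_val_inj /(congr1 val) /= /ord_inj.
pose B (j : 'I_k) : {set star_graph m} :=
  [set u : option 'I_m | if u is Some i then j \in code i else true].
(* A leaf whose code is the full set lies in every [B j], as the centre does; the extra tree [c]
   separates the centre from all leaves. *)
pose c : {set star_graph m} := [set (None : option 'I_m)].
have cardF : #|c |: (B @: [set: 'I_k])| <= k.+1.
  rewrite (leq_trans (leq_card_setU _ _)) // cards1 add1n ltnS.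
  by rewrite (leq_trans (leq_imset_card _ _)) // cardsT card_ord.
apply: leq_trans cardF; apply: fT_le; first exact: star_acyclic.
  move=> _ /setU1P[-> | /imsetP[j _ ->]]; first exact: cutconn1.
  by apply: star_centre_cutconn; rewrite inE.
move=> u v _ _ uv.
have sep_c : isSome u (+) isSome v -> (u \in c) (+) (v \in c).
  by rewrite !inE; case: (u) => [?|]; case: (v).
case: u v uv sep_c => [i|] [i'|] //= uv sep_c;
  do ?by exists c; [rewrite !inE eqxx | exact: sep_c].
apply: contrapT => nosep; case/eqP: uv; congr Some; apply: code_inj.
apply/setP => j; apply: contrapT => /eqP ij; apply: nosep; exists (B j).
  by rewrite inE imset_f ?orbT.
by rewrite !inE; move: ij; do 2!case: (j \in _).
Qed.

Local Open Scope ring_scope.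

(** * Real logarithms and the final estimates *)

Lemma log2_le_nat (R : realType) (n k : nat) :
  (0 < n)%N -> (n <= 2 ^ k)%N -> log2 (n%:R : R) <= k%:R.
Proof.
move=> n0 nk; have ln2 : 0 < ln 2 :> R by rewrite ln_gt0 // ltr1n.
rewrite /log2 ler_pdivrMr // mulr_natl -lnXn // -natrX.
by rewrite ler_ln ?posrE ?ltr0n ?expn_gt0 // ler_nat.
Qed.

Lemma nat_le_log2 (R : realType) (n k : nat) :
  (2 ^ k <= n)%N -> k%:R <= log2 (n%:R : R).
Proof.
move=> kn; have ln2 : 0 < ln 2 :> R by rewrite ln_gt0 // ltr1n.
rewrite /log2 ler_pdivlMr // mulr_natl -lnXn // -natrX.
rewrite ler_ln ?posrE ?ltr0n ?expn_gt0 ?ler_nat //.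
by apply: leq_trans kn; rewrite expn_gt0.
Qed.

Theorem theorem20 (R : realType) :
  [/\ exists C : R, forall (T : sgraph) (n : nat),
        (4 <= n)%N -> #|T| = n -> is_tree T ->
        log2 (n%:R : R) <= (fT T)%:R /\
        (fT T)%:R <= n%:R / 2 + log2 (n%:R : R) + C,
      forall n : nat, (4 <= n)%N -> fT (path_graph n) = uphalf n
    & exists C : R, forall n : nat, (4 <= n)%N ->
        `|(fT (star_graph n.-1))%:R - log2 (n%:R : R)| <= C].
Proof.
split.
(* The bound [n / 2 + 1] is stronger than required; the logarithm is only used to be nonnegative. *)
- exists 1 => T n n4 Tn treeT; split.
    by apply: log2_le_nat; rewrite -?Tn ?card_le_exp_fT // Tn; lia.
  have log_ge0 : 0 <= log2 (n%:R : R) by apply: (@nat_le_log2 R n 0); lia.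
  have le2 : (fT T * 2 <= n + 2)%N by have := fT_le_half treeT; rewrite Tn; lia.
  rewrite -(ler_nat R) natrM natrD in le2.
  lra.
- move=> n n4; apply/eqP; rewrite eqn_leq fT_path_le ?fT_path_ge //; lia.
(* With [t = trunc_log 2 n], the [n - 1] leaves get codes of [t + 1] bits, and the centre costs one
   more tree: [t + 2] in all, where [t] is at most [log2 n]. *)
- exists 2 => n n4.
  have cardS : #|star_graph n.-1| = n by rewrite card_option card_ord; lia.
  have lower : log2 (n%:R : R) <= (fT (star_graph n.-1))%:R.
    by apply: log2_le_nat; rewrite -?{1}cardS ?card_le_exp_fT //; lia.
  have [||lo up] := andP (@trunc_log_bounds 2 n _ _); rewrite ?(ltnW n4) //.
    lia.
  have upper : (fT (star_graph n.-1) <= (trunc_log 2 n).+2)%N.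
    by apply: fT_star_le; lia.
  rewrite -(ler_nat R) -(addn2 (trunc_log 2 n)) natrD in upper.
  have := nat_le_log2 R lo.
  by rewrite ler_norml => ?; apply/andP; split; lra.
Qed.
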